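(* Let $T$ be the full binary tree of height $\omega_1+1$, endowed with the coarse wedge topology. Then every closed subset of $T$ is a Valdivia compact space (in particular, every closed subset of $T$ is weakly Valdivia), but $T$ is not a weakly Corson compact space.
   Context: All topological spaces are assumed Hausdorff and completely regular. Trees. A tree is a partially ordered set $(T,\leq)$ such that for every $t\in T$ the set $\{s\in T: s<t\}$ is well-ordered by $<$. It is rooted if it has exactly one minimal element, and chain complete if every chain (totally ordered subset) has a supremum. For $t\in T$, $\mathrm{ht}(t,T)$ is the order type of $\{s\in T: s<t\}$; for an ordinal $\alpha$, $\mathrm{Lev}_\alpha(T)=\{t\in T:\mathrm{ht}(t,T)=\alpha\}$; the height $\mathrm{ht}(T)$ of $T$ is the least $\alpha$ with $\mathrm{Lev}_\alpha(T)=\emptyset$. The set of immediate successors of $t$ is $\mathrm{ims}(t)=\{s\in T: t\leq s,\ \mathrm{ht}(s,T)=\mathrm{ht}(t,T)+1\}$. A rooted and chain complete tree $T$ is a full binary tree if $|\mathrm{ims}(t)|=2$ for every $t\in T$ with $\mathrm{ht}(t,T)+1<\mathrm{ht}(T)$. For $t\in T$, $\mathrm{cf}(t)$ is the cofinality of $\mathrm{ht}(t,T)$, with the convention $\mathrm{cf}(t)=0$ if $\mathrm{ht}(t,T)$ is $0$ or a successor ordinal. Put $I(T)=\{t\in T:\mathrm{cf}(t)<\omega\}$ and $V_t=\{s\in T: s\geq t\}$. The coarse wedge topology on $T$ is the topology whose subbase consists of the sets $V_t$ and $T\setminus V_t$ for $t\in I(T)$; it is compact Hausdorff when $T$ is rooted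 and chain complete. Compacta. For a set $\Gamma$, let $\Sigma(\Gamma)=\{x\in[0,1]^\Gamma: |\{\gamma\in\Gamma: x(\gamma)\neq0\}|\leq\omega\}$, where $[0,1]^\Gamma$ has the product topology. A compact space $K$ is Valdivia if there are a set $\Gamma$ and a homeomorphic embedding $h:K\to[0,1]^\Gamma$ such that $h^{-1}(\Sigma(\Gamma))$ is dense in $K$. A compact space is weakly Valdivia if it is a continuous image of a Valdivia compact space. A space is countably compact if every countable open cover has a finite subcover. A space is a Corson countably compact if it is homeomorphic to a countably compact subset of $\Sigma(\Gamma)$ for some set $\Gamma$. A compact space is weakly Corson if it is a continuous image of a Corson countably compact space. *)

(* Defs.v *)
From HB Require Import structures.
From mathcomp Require Import all_boot all_order all_algebra.
From mathcomp Require Import all_classical all_reals topology normedtype.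

Set Implicit Arguments.
Unset Strict Implicit.
Unset Printing Implicit Defensive.

Import Order.TTheory GRing.Theory Num.Theory numFieldNormedType.Exports.

Local Open Scope classical_set_scope.

(** * Ordinals, as well-ordered types considered up to isomorphism *)

Definition well_ordered (X : Type) (lt : X -> X -> Prop) : Prop :=
  [/\ forall x y z, lt x y -> lt y z -> lt x z,
      forall x y, [\/ lt x y, x = y | lt y x]
    & well_founded lt].

Definition order_iso (X Y : Type) (ltX : X -> X -> Prop)
    (ltY : Y -> Y -> Prop) : Prop :=
  exists f : X -> Y, bijective f /\ forall x y, ltX x y <-> ltY (f x) (f y).

Definition restrict_rel (X : Type) (lt : X -> X -> Prop) (A : set X) :
    set_type A -> set_type A -> Prop :=
  fun x y => lt (set_val x) (set_val y).

Arguments restrict_rel {X} lt A _ _.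

Record Ord := MkOrd {
  carrier :> Type;
  olt : carrier -> carrier -> Prop;
  olt_wo : well_ordered olt
}.

Definition ord_eq (a b : Ord) : Prop := order_iso (@olt a) (@olt b).

(* [a < b] when [a] is isomorphic to a proper initial segment of [b]. *)
Definition ord_lt (a b : Ord) : Prop :=
  exists x : b, order_iso (@olt a) (restrict_rel (@olt b) [set y | olt y x]).

Definition least_ord (P : Ord -> Prop) (a : Ord) : Prop :=
  P a /\ forall b, ord_lt b a -> ~ P b.

Lemma zero_wo : well_ordered (fun _ _ : void => False).
Proof. by split=> -[]. Qed.

Definition ord_zero : Ord := MkOrd zero_wo.

(* [None] is the new top element. *)
Definition succ_lt (X : Type) (lt : X -> X -> Prop) (x y : option X) : Prop :=
  match x, y with
  | Some x', Some y' => lt x' y'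
  | Some _, None => True
  | None, _ => False
  end.

Lemma succ_wo (a : Ord) : well_ordered (succ_lt (@olt a)).
Proof.
have [tr tot wf] := olt_wo a; split.
- by move=> [x|] [y|] [z|] //=; exact: tr.
- move=> [x|] [y|] /=; try by constructor.
  by have [?|->|?] := tot x y; constructor.
- have accS x : Acc (succ_lt (@olt a)) (Some x).
    by elim: (wf x) => {}x _ IH; constructor=> -[y|] lyx; [exact: IH|case: lyx].
  move=> [x|]; first exact: accS.
  by constructor=> -[y|] ly; [exact: accS|case: ly].
Qed.

Definition ord_succ (a : Ord) : Ord := MkOrd (succ_wo a).

Lemma omega_wo : well_ordered (fun m n : nat => (m < n)%N).
Proof.
split.
- by move=> m n p; exact: ltn_trans.
- by move=> m n; case: (ltngtP m n) => ?; constructor.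
- elim/ltn_ind => n IH; constructor=> m ltmn; exact: IH.
Qed.

Definition ord_omega : Ord := MkOrd omega_wo.

Definition is_omega1 (a : Ord) : Prop :=
  least_ord (fun b => ~ countable [set: b]) a.

Definition cofinal (a : Ord) (C : set a) : Prop :=
  forall x : a, exists2 y, C y & olt x y \/ x = y.

Definition is_cofinality (a k : Ord) : Prop :=
  least_ord (fun b => exists2 C : set a,
    cofinal C & order_iso (restrict_rel (@olt a) C) (@olt b)) k.

Definition zero_or_succ (a : Ord) : Prop :=
  ord_eq a ord_zero \/ exists b, ord_eq a (ord_succ b).

(** * Trees *)

Section Trees.
Context {d : Order.disp_t} (T : porderType d).
Implicit Types (s t : T) (a b k : Ord).

Definition below_lt (t : T) :=
  restrict_rel (fun s s' : T => (s < s')%O) [set s | (s < t)%O].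

Arguments below_lt t _ _ : clear implicits.

Definition is_tree : Prop := forall t, well_ordered (below_lt t).

Definition rooted : Prop := exists! r : T, forall s, (s <= r)%O -> s = r.

Definition chain_complete : Prop :=
  forall C : set T, total_on C (fun s t => (s <= t)%O) -> supremums C !=set0.

(* [has_ht t a] is ht(t,T) = a; ordinals being taken up to isomorphism, heights
   (and cofinalities below) are relations rather than functions. *)
Definition has_ht t a : Prop := order_iso (below_lt t) (@olt a).

Definition Lev a : set T := [set t | has_ht t a].

Definition tree_ht : Ord -> Prop := least_ord (fun a => Lev a = set0).

Definition ims t : set T :=
  [set s | (t <= s)%O /\ exists2 a, has_ht t a & has_ht s (ord_succ a)].

Definition full_binary_tree : Prop :=
  [/\ is_tree, rooted, chain_complete
    & forall t a b, has_ht t a -> tree_ht b -> ord_lt (ord_succ a) b ->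
        (ims t #= `I_2)%card].

Definition has_cf t k : Prop :=
  exists2 a, has_ht t a &
    (zero_or_succ a /\ ord_eq k ord_zero) \/
    (~ zero_or_succ a /\ is_cofinality a k).

Definition Iset : set T :=
  [set t | exists2 k, has_cf t k & ord_lt k ord_omega].

Definition Vset t : set T := [set s | (t <= s)%O].

Definition wedge_subbase : set (set T) :=
  [set U | exists2 t, Iset t & U = Vset t \/ U = ~` Vset t].

End Trees.

(* A copy of [T] carrying the coarse wedge topology. *)
Definition coarse_wedge {d : Order.disp_t} (T : porderType d) : Type := T.

HB.instance Definition _ {d : Order.disp_t} (T : porderType d) :=
  Order.POrder.on (coarse_wedge T).
HB.instance Definition _ {d : Order.disp_t} (T : porderType d) :=
  @isSubBaseTopological.Build (coarse_wedge T) (set T) (@wedge_subbase d T) id.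

(** * Classes of compacta *)

Definition compact_space (K : topologicalType) : Prop :=
  hausdorff_space K /\ compact [set: K].

Definition countably_compact_space (X : topologicalType) : Prop :=
  forall (I : choiceType) (D : set I) (U : I -> set X),
    countable D -> (forall i, D i -> open (U i)) ->
    [set: X] `<=` cover D U -> finite_subset_cover D U [set: X].

Definition homeo_embedding (X Y : topologicalType) (h : X -> Y) : Prop :=
  [/\ injective h, continuous h
    & forall U : set X, open U -> exists2 V : set Y, open V & U = h @^-1` V].

Definition homeomorphic (X Y : topologicalType) : Prop :=
  exists (f : X -> Y) (g : Y -> X),
    [/\ continuous f, continuous g, cancel f g & cancel g f].

Definition continuous_image_of (L K : topologicalType) : Prop :=
  exists2 f : L -> K, continuous f & range f = [set: K].

Section Compacta.
Context (R : realType).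
Local Open Scope ring_scope.

Definition unit_itv : set R := `[0, 1]%classic.

Definition cube (G : Type) : topologicalType :=
  {ptws G -> set_type unit_itv}.

Definition Sigma (G : Type) : set (cube G) :=
  [set x : cube G | countable [set g | set_val (x g) <> 0 :> R]].

Arguments Sigma G _ : clear implicits.

Definition valdivia (K : topologicalType) : Prop :=
  compact_space K /\
  exists (G : Type) (h : K -> cube G),
    homeo_embedding h /\ dense (h @^-1` Sigma G).

Definition weakly_valdivia (K : topologicalType) : Prop :=
  compact_space K /\
  exists2 L : topologicalType, valdivia L & continuous_image_of L K.

Definition corson_countably_compact (X : topologicalType) : Prop :=
  exists (G : Type) (A : set (cube G)),
    [/\ A `<=` Sigma G, countably_compact_space (set_type A)
      & homeomorphic X (set_type A)].

Definition weakly_corson (K : topologicalType) : Prop :=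
  compact_space K /\
  exists2 L : topologicalType,
    corson_countably_compact L & continuous_image_of L K.

End Compacta.

(* Main.v *)
Require Import Defs.
From mathcomp Require Import all_boot all_order all_algebra finmap.
From mathcomp Require Import all_classical all_reals topology normedtype.

Set Implicit Arguments.
Unset Strict Implicit.
Unset Printing Implicit Defensive.

Import Order.TTheory GRing.Theory Num.Theory numFieldNormedType.Exports.

Local Open Scope classical_set_scope.

(** The proof first removes the ordinals.  Comparability of well-orders
    ([ord_trichotomy]) and the definition of heights give the facts about the
    order of [T] that matter: sets of strict predecessors are well-ordered,
    chains have suprema, every node that is not maximal has countably many strict
    predecessors, every node with countably many of them has two incompatible
    nodes above it, and [Iset] consists of the nodes that are minimal or have an
    immediate predecessor ([full_binary_omega1_tree], [full_binary_splits]).  A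
    node is called countable when it has countably many strict predecessors.

    Closed subsets are Valdivia.  On the whole tree, the characteristic functions
    of the wedges [Vset r] with [r] in [Iset] give an embedding into a cube under
    which the countable nodes, which are dense, have countable support.  In a
    closed set [F] the countable nodes may fail to be dense.  But if a wedge meets
    [F] in uncountable nodes only, those nodes are isolated in [F]
    ([wedge_isolates_uncountable_node]): otherwise a sequence of nodes of [F] in
    this wedge would converge to a countable node.  So one keeps the wedges that
    meet [F] in some countable node and replaces the others by the singletons of
    the isolated uncountable nodes ([closed_valdivia]).

    The tree is not weakly Corson.  Let [f] map a countably compact subspace [X]
    of a Sigma-product continuously onto [T].  The points of [X] supported in a
    countable set [N] form a separable space, and above any countable node there
    is a wedge that misses a given countable subset of [T]; hence that wedge
    misses the images of all these points ([avoid_support]).  By countable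
    compactness, the points over the wedge even have supports meeting
    [M] minus [N] for one countable set [M] ([new_coordinates]).  Iterating
    uncountably often, with suprema at limit steps, gives an increasing family of
    nodes along which new coordinates must be added each time.  A point over the
    supremum of these nodes would have uncountable support
    ([no_surjection_onto_tree]). *)

(** * Countable sets and well-orders *)

Lemma countable_inj_on (X Y : Type) (f : X -> Y) (A : set X) (B : set Y) :
  (forall x y, A x -> A y -> f x = f y -> x = y) ->
  (forall x, A x -> B (f x)) -> countable B -> countable A.
Proof.
move=> finj fB /countable_injP[g ginj]; apply/countable_injP.
exists (g \o f) => x y /set_mem Ax /set_mem Ay e.
by apply: finj => //; apply: ginj e; apply: mem_set; exact: fB.
Qed.

Lemma countable_setU (X : Type) (A B : set X) :
  countable A -> countable B -> countable (A `|` B).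
Proof.
move=> cA cB.
have -> : A `|` B = \bigcup_(b in [set: bool]) (if b then A else B).
  apply/seteqP; split=> [x [Ax|Bx]|x [[] _ Ax]]; last 2 first.
  - by left.
  - by right.
  - by exists true.
  - by exists false.
by apply: bigcup_countable => // -[].
Qed.

Lemma well_founded_least (X : Type) (lt : X -> X -> Prop) (P : set X) :
  well_founded lt -> P !=set0 ->
  exists2 x, P x & forall y, lt y x -> ~ P y.
Proof.
move=> wf [x0 Px0]; apply: contrapT => noleast.
suff noP x : ~ P x by exact: noP Px0.
elim/(well_founded_ind wf): x => x IH Px; apply: noleast.
by exists x.
Qed.

Lemma olt_irr (a : Ord) (x : a) : ~ olt x x.
Proof.
have [_ _ wf] := olt_wo a.
elim/(well_founded_ind wf): x => x IH lx; exact: (IH x).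
Qed.

(** A strictly increasing self-map of a well-order never decreases a point:
    the least decreased point would be sent to a smaller decreased point. *)
Lemma increasing_self_map (a : Ord) (f : a -> a) :
  (forall x y, olt x y -> olt (f x) (f y)) -> forall x, ~ olt (f x) x.
Proof.
move=> fmono; have [_ _ wf] := olt_wo a.
elim/(well_founded_ind wf) => x IH fx.
exact: IH fx (fmono _ _ fx).
Qed.

Lemma order_iso_of_rel (X Y : Type) (ltX : X -> X -> Prop)
    (ltY : Y -> Y -> Prop) (E : X -> Y -> Prop) :
  (forall x, exists y, E x y) -> (forall y, exists x, E x y) ->
  (forall x y x' y', E x y -> E x' y' -> x = x' <-> y = y') ->
  (forall x y x' y', E x y -> E x' y' -> ltX x x' <-> ltY y y') ->
  order_iso ltX ltY.
Proof.
move=> /choice[f fE] /choice[g gE] Einj Emono; exists f; split.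
- exists g => [x|y].
  + by apply/(Einj _ _ _ _ (gE (f x)) (fE x)).
  + by apply/(Einj _ _ _ _ (fE (g y)) (gE y)).
- by move=> x y; exact: Emono.
Qed.

Lemma order_iso_restrictP (X Y : Type) (ltX : X -> X -> Prop)
    (ltY : Y -> Y -> Prop) (A : set Y) :
  order_iso ltX (restrict_rel ltY A) <->
  exists f : X -> Y, [/\ injective f, range f = A
    & forall x y, ltX x y <-> ltY (f x) (f y)].
Proof.
split=> [[f [[g fK gK] fmono]]|[f [finj fA fmono]]].
- exists (fun x => val (f x)); split=> [x y /val_inj /(can_inj fK)//| |x y].
  + apply/seteqP; split=> [_ [x _ <-]|y Ay]; first exact: set_valP.
    by exists (g (exist _ y (mem_set Ay))) => //; rewrite gK.
  + exact: fmono.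
- apply: (@order_iso_of_rel _ _ _ _ (fun x y => f x = val y)).
  + move=> x; have Afx : A (f x) by rewrite -fA; exists x.
    by exists (exist _ (f x) (mem_set Afx)).
  + move=> y; have [x _ <-] : range f (val y) by rewrite fA; exact: set_valP.
    by exists x.
  + move=> x y x' y' exy ex'y'; split=> [xx'|yy'].
      by apply: val_inj; rewrite /= -exy -ex'y' xx'.
    by apply: finj; rewrite exy ex'y' yy'.
  + by move=> x y x' y' exy ex'y'; rewrite fmono exy ex'y'.
Qed.

Lemma order_iso_sym (X Y : Type) (ltX : X -> X -> Prop)
    (ltY : Y -> Y -> Prop) : order_iso ltX ltY -> order_iso ltY ltX.
Proof.
move=> [f [[g fK gK] fmono]]; exists g; split; first by exists f.
by move=> x y; rewrite fmono !gK.
Qed.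

(** [same_rank x y] says that the initial segments below [x] and [y] are
    isomorphic; matching each other's elements back and forth defines it without
    mentioning an isomorphism. *)
Inductive same_rank (a b : Ord) (x : a) (y : b) : Prop :=
  SameRank of (forall x', olt x' x -> exists2 y', olt y' y & same_rank x' y')
            & (forall y', olt y' y -> exists2 x', olt x' x & same_rank x' y').

Lemma same_rank_sym (a b : Ord) (x : a) (y : b) :
  same_rank x y -> same_rank y x.
Proof.
have [_ _ wf] := olt_wo a.
elim/(well_founded_ind wf): x y => x IH y [xy yx].
by split=> z lz; [have [w lw E] := yx _ lz|have [w lw E] := xy _ lz];
  exists w => //; apply: IH.
Qed.

Lemma same_rank_fun (a b : Ord) (x : a) (y y' : b) :
  same_rank x y -> same_rank x y' -> y = y'.
Proof.
have [_ _ wf] := olt_wo a; have [_ tot _] := olt_wo b.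
elim/(well_founded_ind wf): x y y' => x IH y y' [xy yx] [xy' y'x].
have [lyy'|//|ly'y] := tot y y'.
- have [x' lx' E] := y'x _ lyy'; have [y2 ly2 E2] := xy _ lx'.
  by have e := IH _ lx' _ _ E E2; case: (olt_irr (x := y)); rewrite {1}e.
- have [x' lx' E] := yx _ ly'y; have [y2 ly2 E2] := xy' _ lx'.
  by have e := IH _ lx' _ _ E E2; case: (olt_irr (x := y')); rewrite {1}e.
Qed.

Lemma same_rank_inj (a b : Ord) (x x' : a) (y : b) :
  same_rank x y -> same_rank x' y -> x = x'.
Proof. by move=> /same_rank_sym + /same_rank_sym; exact: same_rank_fun. Qed.

Lemma same_rank_mono (a b : Ord) (x x' : a) (y y' : b) :
  same_rank x y -> same_rank x' y' -> olt x x' <-> olt y y'.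
Proof.
move=> Exy Ex'y'; split=> l.
- have [y2 ly2 E] : exists2 z, olt z y' & same_rank x z.
    by case: Ex'y' => + _; exact.
  by rewrite (same_rank_fun Exy E).
- have [x2 lx2 E] : exists2 z, olt z x' & same_rank z y.
    by case: Ex'y' => _; exact.
  by rewrite (same_rank_inj Exy E).
Qed.

(** Two well-orders are comparable: the relation [same_rank] matches an initial
    segment of one with an initial segment of the other, and if both were
    proper, the least unmatched elements would match. *)
Lemma ord_trichotomy (a b : Ord) : [\/ ord_lt a b, ord_eq a b | ord_lt b a].
Proof.
have [tra tota wfa] := olt_wo a; have [trb totb wfb] := olt_wo b.
pose D := [set x : a | exists y : b, same_rank x y].
pose D' := [set y : b | exists x : a, same_rank x y].
have Ddown x x' : D x -> olt x' x -> D x'.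
  by move=> [y [xy _]] /xy [y' _ E]; exists y'.
have D'down y y' : D' y -> olt y' y -> D' y'.
  by move=> [x [_ yx]] /yx [x' _ E]; exists x'.
have Einj (x : a) (y : b) x' y' :
    same_rank x y -> same_rank x' y' -> x = x' <-> y = y'.
  move=> E E'; split=> e.
    by apply: (same_rank_fun E); rewrite e.
  by apply: (same_rank_inj E); rewrite e.
have [allD|nD] := pselect (forall x, D x);
have [allD'|nD'] := pselect (forall y, D' y).
- constructor 2; apply: (order_iso_of_rel allD allD' Einj).
  by move=> x y x' y'; exact: same_rank_mono.
- have /(well_founded_least wfb)[y0 ny0 ley0] : ~` D' !=set0.
    by apply/set0P/eqP => e; apply: nD' => y; apply: contrapT => ny;
      have : (~` D') y by []; rewrite e.
  constructor 1; exists y0; apply/order_iso_restrictP.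
  have [f fE] := choice allD; exists f; split.
  + by move=> x x' ff'; apply/(Einj _ _ _ _ (fE x) (fE x')).
  + apply/seteqP; split=> [_ [x _ <-] /=|y /= ly].
    * have [//|e|l] := totb (f x) y0.
        by case: ny0; exists x; rewrite -e.
      by case: ny0; apply: D'down l; exists x.
    * have /contrapT[x E] := ley0 _ ly.
      by exists x => //; exact: same_rank_fun (fE x) E.
  + by move=> x x'; exact: same_rank_mono.
- have /(well_founded_least wfa)[x0 nx0 lex0] : ~` D !=set0.
    by apply/set0P/eqP => e; apply: nD => y; apply: contrapT => ny;
      have : (~` D) y by []; rewrite e.
  constructor 3; exists x0; apply/order_iso_restrictP.
  have [f fE] := choice allD'; exists f; split.
  + by move=> x x' ff'; apply/(Einj _ _ _ _ (fE x) (fE x')).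
  + apply/seteqP; split=> [_ [x _ <-] /=|y /= ly].
    * have [//|e|l] := tota (f x) x0.
        by case: nx0; exists x; rewrite -e.
      by case: nx0; apply: Ddown l; exists x.
    * have /contrapT[x E] := lex0 _ ly.
      by exists x => //; exact: same_rank_inj (fE x) E.
  + by move=> y y'; apply: iff_sym; exact: same_rank_mono.
- have /(well_founded_least wfb)[y0 ny0 ley0] : ~` D' !=set0.
    by apply/set0P/eqP => e; apply: nD' => y; apply: contrapT => ny;
      have : (~` D') y by []; rewrite e.
  have /(well_founded_least wfa)[x0 nx0 lex0] : ~` D !=set0.
    by apply/set0P/eqP => e; apply: nD => y; apply: contrapT => ny;
      have : (~` D) y by []; rewrite e.
  case: (nx0); exists y0; split=> [x lx|y ly].
  + have /contrapT[y E] := lex0 _ lx; exists y => //.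
    have [//|e|l] := totb y y0.
      by case: ny0; exists x; rewrite -e.
    by case: ny0; apply: D'down l; exists x.
  + have /contrapT[x E] := ley0 _ ly; exists x => //.
    have [//|e|l] := tota x x0.
      by case: nx0; exists y; rewrite -e.
    by case: nx0; apply: Ddown l; exists y.
Qed.

Lemma ord_lt_countable (a b : Ord) : ord_lt a b ->
  countable [set: b] -> countable [set: a].
Proof.
move=> [x /order_iso_restrictP[f [finj _ _]]].
by apply: (countable_inj_on (f := f)) => // y z _ _; exact: finj.
Qed.

Lemma ord_eq_countable (a b : Ord) : ord_eq a b ->
  countable [set: b] -> countable [set: a].
Proof.
move=> [f [[g fK _] _]].
by apply: (countable_inj_on (f := f)) => // y z _ _; exact: (can_inj fK).
Qed.

(** * Trees and heights *)

Section HeightTheory.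
Context {d : Order.disp_t} (T : porderType d).
Implicit Types (s t u v : T) (a : Ord).

Definition below t := [set s | (s < t)%O].

Lemma has_htP t a : has_ht t a <->
  exists f : a -> T, [/\ injective f, range f = below t
    & forall x y, olt x y <-> (f x < f y)%O].
Proof.
by split=> [/order_iso_sym/order_iso_restrictP//|fP];
  apply: order_iso_sym; apply/order_iso_restrictP.
Qed.

Lemma range_below (I : Type) (f : I -> T) t :
  range f = below t -> forall x, (f x < t)%O.
Proof. by move=> ft x; have : below t (f x) by rewrite -ft; exists x. Qed.

(** Otherwise the initial segment below [t] would be isomorphic to a longer one,
    against [increasing_self_map]. *)
Lemma same_ht_not_lt t t' a : has_ht t a -> has_ht t' a -> ~ (t < t')%O.
Proof.
move=> /has_htP[f [finj ft fmono]] /has_htP[g [ginj gt' gmono]] ltt'.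
have [z _ gz] : range g t by rewrite gt'.
have /choice[h hE] x : exists y, g y = f x.
  have : below t' (f x) by exact: lt_trans (range_below ft x) ltt'.
  by rewrite -gt' => -[y _ <-]; exists y.
apply: (@increasing_self_map a h _ z) => [x y|].
- by rewrite fmono gmono !hE.
- by rewrite gmono hE gz; exact: range_below ft z.
Qed.

Hypothesis treeT : is_tree T.

Definition ord_below t : Ord := MkOrd (treeT t).

Lemma has_ht_below t : has_ht t (ord_below t).
Proof. by exists id; split=> //; exists id. Qed.

Lemma below_countableP t :
  countable [set: ord_below t] <-> countable (below t).
Proof.
split.
- have [f [finj ft _]] := (has_htP _ _).1 (has_ht_below t).
  rewrite -ft => c; apply: sub_countable c; exact: card_image_le.
- have [f [finj ft _]] := (has_htP _ _).1 (has_ht_below t).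
  apply: (countable_inj_on (f := f)) => // [x y _ _|x _]; first exact: finj.
  by rewrite -ft; exists x.
Qed.

Lemma tree_total s u t : (s <= t)%O -> (u <= t)%O -> (s <= u)%O || (u <= s)%O.
Proof.
rewrite !le_eqVlt => /orP[/eqP-> /orP[/eqP->|->]|lst /orP[/eqP->|lut]];
  rewrite ?eqxx ?lst ?orbT//.
have [_ tot _] := treeT t.
have [/= l|[->]|/= l] := tot (exist _ s (mem_set lst : s \in below t))
  (exist _ u (mem_set lut)); rewrite ?eqxx//.
all: by move: l; rewrite /below_lt /restrict_rel /= => ->; rewrite !orbT.
Qed.

Lemma tree_wf : well_founded (fun s t : T => (s < t)%O).
Proof.
move=> t; constructor=> s0 lst.
have [_ _ wf] := treeT t.
suff H (x : set_type (below t)) : Acc (fun s t : T => (s < t)%O) (val x).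
  exact: (H (exist _ s0 (mem_set lst : s0 \in below t))).
elim/(well_founded_ind wf): x => x IH; constructor=> s lsx.
have lst' : below t s by apply: lt_trans lsx _; exact: set_valP x.
exact: (IH (exist _ s (mem_set lst'))).
Qed.

(** The immediate successors in the sense of heights are the immediate
    successors of the order. *)
Lemma imsP t u : ims t u -> (t < u)%O /\ forall s, (s < u)%O -> (s <= t)%O.
Proof.
move=> [letu [a hta /has_htP[f [finj fu fmono]]]].
pose m := f None.
have mu : (m < u)%O by exact: range_below fu None.
have maxm s : below u s -> (s <= m)%O.
  rewrite -fu => -[[x|] _ <-] //; apply/ltW; exact/(fmono (Some x) None).
have hm : has_ht m a.
  apply/has_htP; exists (fun x => f (Some x)); split.
  - by move=> x y /finj[].
  - apply/seteqP; split=> [_ [x _ <-]|s sm].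
      exact/(fmono (Some x) None).
    have : below u s by exact: lt_trans sm mu.
    rewrite -fu => -[[x|] _ e]; first by exists x.
    by move: sm; rewrite -e /below /= ltxx.
  - by move=> x y; exact: (fmono (Some x) (Some y)).
suff -> : t = m by split.
have := tree_total letu (ltW mu).
rewrite !le_eqVlt => /orP[/orP[/eqP//|l]|/orP[/eqP//|l]].
- by case: (same_ht_not_lt hta hm).
- by case: (same_ht_not_lt hm hta).
Qed.

(** The nodes of finite cofinality, in order terms: minimal, or with a greatest
    strict predecessor. *)
Definition isolated_node t :=
  below t = set0 \/ exists2 p, (p < t)%O & forall s, (s < t)%O -> (s <= p)%O.

Lemma zero_or_succ_isolated t a :
  has_ht t a -> zero_or_succ a -> isolated_node t.
Proof.
move=> /has_htP[f [finj ft fmono]] [[g _]|[b [g [[h gK hK] gmono]]]].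
- left; rewrite -ft; apply/seteqP; split=> // _ [x _ <-]; by case: (g x).
- right; exists (f (h None)); first exact: range_below ft _.
  move=> s lst; have : below t s by []; rewrite -ft => -[x _ <-].
  case e : (g x) => [y|]; last by rewrite -e gK.
  by apply/ltW/fmono/gmono; rewrite hK e.
Qed.

Lemma isolated_zero_or_succ t :
  isolated_node t -> zero_or_succ (ord_below t).
Proof.
move=> [t0|[p lpt maxp]].
- left; have no (x : ord_below t) : False.
    have : below t (val x) by exact: set_valP.
    by rewrite [X in X _]t0.
  exists (fun x => False_rect _ (no x)); split=> [|x]; last by case: (no x).
  by exists (fun v : void => match v with end) => [x|[]]; case: (no x).
- right; exists (ord_below p); apply: order_iso_sym.
  apply/order_iso_restrictP.
  exists (fun x => if x is Some y then val y else p); split.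
  + have pN (x : ord_below p) : val x <> p.
      by move=> e; have : below p (val x) by [exact: set_valP];
        rewrite /below /= e ltxx.
    move=> [x|] [y|] // e; first by rewrite (val_inj e).
      by case: (pN x).
    by case: (pN y).
  + apply/seteqP; split=> [_ [[x|] _ <-]//|s /= lst].
      by apply: lt_trans lpt; exact: set_valP x.
    have := maxp _ lst; rewrite le_eqVlt => /orP[/eqP->|lsp].
      by exists None.
    by exists (Some (exist _ s (mem_set (lsp : below p s)))).
  + move=> [x|] [y|] //=.
    * by split=> // _; exact: set_valP x.
    * split=> // l; have := lt_trans l (set_valP y : (val y < p)%O).
      by rewrite ltxx.
    * by rewrite ltxx.
Qed.

(** A cofinal set of finite order type in a nonempty order has a greatest
    element, which is then the greatest element of the whole order. *)
Lemma Iset_isolated t : Iset t <-> isolated_node t.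
Proof.
split=> [[k [a hta [[za _]|[_ [[C Ccof iso] _]]]] [n isok]]|it].
- exact: zero_or_succ_isolated za.
- have [f [finj ft fmono]] := (has_htP _ _).1 hta.
  have [g [[h gK hK] gmono]] := iso.
  have [e [einj en emono]] := (order_iso_restrictP _ _ _).1 isok.
  case: n isok en => [|n] _ en.
    left; rewrite -ft; apply/seteqP; split=> // _ [x _ <-].
    have [y Cy _] := Ccof x.
    have : [set m : nat | (m < 0)%N] (e (g (exist _ y (mem_set Cy)))).
      by rewrite -[X in X _]en; eexists.
    by rewrite /= ltn0.
  have [z _ ez] : range e n by rewrite en /=.
  pose m : a := val (h z).
  right; exists (f m); first exact: range_below ft m.
  have maxm y (Cy : C y) : olt y m \/ y = m.
    pose y' : set_type C := exist _ y (mem_set Cy).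
    have : [set m : nat | (m < n.+1)%N] (e (g y')).
      by rewrite -[X in X _]en; eexists.
    rewrite /= ltnS leq_eqVlt => /orP[/eqP|].
      by rewrite -ez => /einj gy; right; rewrite /m -gy gK.
    by rewrite -ez => /emono; rewrite -(hK z) => /gmono; left.
  have [tr _ _] := olt_wo a.
  move=> s lst; have : below t s by []; rewrite -ft => -[x _ <-].
  suff [l|->] : olt x m \/ x = m by [exact/ltW/fmono|].
  have [y Cy [xy|->]] := Ccof x; last exact: maxm.
  by have [ym|<-] := maxm y Cy; left => //; exact: tr ym.
- exists ord_zero.
    exists (ord_below t); first exact: has_ht_below.
    left; split; first exact: isolated_zero_or_succ.
    by exists id; split=> //; exists id.
  exists 0%N; apply/order_iso_restrictP.
  by exists (fun v : void => match v with end); split=> [[]||[]//];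
    apply/seteqP; split=> [_ [[]]|].
Qed.

End HeightTheory.

Definition countable_node {d : Order.disp_t} (T : porderType d) (t : T) : Prop :=
  countable (below t).

(** The trees of height at most [omega1 + 1] with suprema of chains, described
    without ordinals: [countable_below] bounds the height, and [IsetE] replaces
    the cofinalities in the definition of [Iset]. *)
Record omega1_tree {d : Order.disp_t} (T : porderType d) : Prop := Omega1Tree {
  comparable_below : forall s u t : T,
    (s <= t)%O -> (u <= t)%O -> (s <= u)%O || (u <= s)%O;
  lt_wf : well_founded (fun s t : T => (s < t)%O);
  chain_sup : chain_complete T;
  countable_below : forall s t : T, (s < t)%O -> countable_node s;
  IsetE : forall t : T, Iset t <-> isolated_node t
}.

Definition splits_countable_nodes {d : Order.disp_t} (T : porderType d) : Prop :=
  forall t : T, countable_node t -> exists u v : T,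
    [/\ (t < u)%O, (t < v)%O, countable_node u, countable_node v
      & forall w, ~ ((u <= w)%O /\ (v <= w)%O)].

(** A node of uncountable height with a node above it would yield a node of
    height [omega1 + 1]: a least node of uncountable height has height [omega1],
    and it would have an immediate successor. *)
Lemma full_binary_omega1_tree (d : Order.disp_t) (T : porderType d)
    (omega1 : Ord) : is_omega1 omega1 -> full_binary_tree T ->
  tree_ht T (ord_succ omega1) -> omega1_tree T.
Proof.
move=> [unc1 min1] [treeT _ ccT _] [lev0 _].
split; [exact: tree_total|exact: tree_wf|exact: ccT| |exact: Iset_isolated].
move=> s t lst; apply: contrapT => nc.
have [u [leus ncu] minu] : exists2 u, (u <= s)%O /\ ~ countable (below u) &
    forall v, (v < u)%O -> ~ ((v <= s)%O /\ ~ countable (below v)).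
  by apply: (well_founded_least (tree_wf treeT)); exists s.
have hu : has_ht u omega1.
  have [l|//|[v /order_iso_restrictP[f [finj fv _]]]] :=
    ord_trichotomy (ord_below treeT u) omega1.
  - by have := min1 _ l; rewrite below_countableP.
  - have lvu : (val v < u)%O by exact: set_valP v.
    case: (minu (val v) lvu); split; first exact: le_trans (ltW lvu) leus.
    move=> cv; apply: unc1.
    apply: (countable_inj_on (f := fun x => val (f x)) _ _ cv).
      by move=> x y _ _ /val_inj; exact: finj.
    move=> x _; suff : [set y | olt y v] (f x) by [].
    by rewrite -fv; exists x.
have ltut : (u < t)%O by exact: le_lt_trans lst.
have [w [ltuw lewt] minw] : exists2 w, (u < w)%O /\ (w <= t)%O &
    forall v, (v < w)%O -> ~ ((u < v)%O /\ (v <= t)%O).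
  by apply: (well_founded_least (tree_wf treeT)); exists t.
suff : Lev (ord_succ omega1) w by rewrite lev0.
have [f [finj fu fmono]] := (has_htP _ _).1 hu.
apply/has_htP; exists (fun x => if x is Some y then f y else u); split.
- have fN x : f x <> u by move=> e; have := range_below fu x; rewrite e ltxx.
  move=> [x|] [y|] //; first by move=> /finj ->.
    by move=> /fN.
  by move=> /esym/fN.
- apply/seteqP; split=> [_ [[x|] _ <-]//|v ltvw].
    exact: lt_trans (range_below fu x) ltuw.
  have := tree_total treeT (ltW ltvw) (ltW ltuw).
  rewrite !le_eqVlt => /orP[/orP[/eqP->|ltvu]|/orP[/eqP<-|ltuv]].
  + by exists None.
  + have : below u v by []; rewrite -fu => -[x _ <-]; by exists (Some x).
  + by exists None.
  + case: (minw v ltvw); split=> //; exact: le_trans (ltW ltvw) lewt.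
- move=> [x|] [y|] //=.
  + by split=> // _; exact: range_below fu x.
  + by split=> // l; have := lt_trans l (range_below fu y); rewrite ltxx.
  + by rewrite ltxx.
Qed.

(** A node of countable height has height less than [omega1], so that it has two
    immediate successors, which are incomparable. *)
Lemma full_binary_splits (d : Order.disp_t) (T : porderType d)
    (omega1 : Ord) : is_omega1 omega1 -> full_binary_tree T ->
  tree_ht T (ord_succ omega1) -> splits_countable_nodes T.
Proof.
move=> [unc1 _] [treeT _ _ binT] htT t ct.
set a := ord_below treeT t.
have ca : countable [set: ord_succ a].
  rewrite (_ : setT = [set None] `|` [set Some x | x in [set: a]]).
    apply: countable_setU => //.
    apply: sub_countable (card_image_le _ _) _; exact/below_countableP.
  by apply/seteqP; split=> // -[x|] _; [right; exists x|left].
have lt1 : ord_lt (ord_succ a) (ord_succ omega1).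
  have [[z /order_iso_restrictP[f [finj fz fmono]]]|e|l] :=
    ord_trichotomy (ord_succ a) omega1.
  - exists (Some z); apply/order_iso_restrictP.
    exists (fun x => Some (f x)); split => [x y [/finj//]||x y].
      apply/seteqP; split=> [_ [x _ <-] /=|[y|]//= ly].
        by have : [set y | olt y z] (f x) by rewrite -fz; exists x.
      by have : [set y | olt y z] y by []; rewrite -fz => -[x _ <-]; exists x.
    exact: fmono.
  - case: unc1; apply: ord_eq_countable ca; exact: order_iso_sym e.
  - by case: unc1; exact: ord_lt_countable l ca.
have /card_eqPle[_ /card_leP[f]] :=
  binT t a _ (has_ht_below treeT t) htT lt1.
have I0 : `I_2 0%N by []. have I1 : `I_2 1%N by [].
pose u : T := val (f (exist _ 0%N (mem_set I0))).
pose v : T := val (f (exist _ 1%N (mem_set I1))).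
have uv : u <> v.
  by move=> /val_inj e; have := 'inj_f (mem_set Logic.I) (mem_set Logic.I) e.
have [ltu maxu] := imsP treeT (set_valP (f (exist _ 0%N (mem_set I0)))).
have [ltv maxv] := imsP treeT (set_valP (f (exist _ 1%N (mem_set I1)))).
have cims w : (forall s, (s < w)%O -> (s <= t)%O) -> countable_node w.
  move=> maxw; apply: (@sub_countable _ _ _ (below t `|` [set t])).
    apply: subset_card_le => s /maxw; rewrite le_eqVlt => /orP[/eqP->|];
    by [right|left].
  exact: countable_setU.
exists u, v; split=> //; [exact: cims|exact: cims|].
move=> w [uw vw]; have := tree_total treeT uw vw.
rewrite !le_eqVlt => /orP[/orP[/eqP//|/maxv]|/orP[/eqP/esym//|/maxu]].
- by move=> /(lt_le_trans ltu); rewrite ltxx.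
- by move=> /(lt_le_trans ltv); rewrite ltxx.
Qed.

(** * The coarse wedge topology *)

Section WedgeTopology.
Context {d : Order.disp_t} (T : porderType d).
Implicit Types (p q r s t : T).

Lemma open_subbase (U : set T) :
  wedge_subbase U -> open (U : set (coarse_wedge T)).
Proof.
move=> sU; exists [set U]; last by rewrite bigcup_set1.
move=> _ ->; exists [fset U]%fset; first by move=> V /fset1P ->; rewrite inE.
by apply/seteqP; split=> [x|x Ux V /fset1P -> //]; apply; exact/fset1P.
Qed.

Lemma open_Vset t : Iset t -> open (Vset t : set (coarse_wedge T)).
Proof. by move=> It; apply: open_subbase; exists t => //; left. Qed.

Lemma open_VsetC t : Iset t -> open (~` Vset t : set (coarse_wedge T)).
Proof. by move=> It; apply: open_subbase; exists t => //; right. Qed.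

Lemma wedge_cvg (F : set_system (coarse_wedge T)) (p : coarse_wedge T) :
  Filter F ->
  (forall t : T, Iset t -> (t <= p)%O -> F (Vset t)) ->
  (forall t : T, Iset t -> ~ (t <= p)%O -> F (~` Vset t)) ->
  F --> p.
Proof.
move=> FF Fle Fnle A /=; rewrite nbhsE => -[_ [[B sB <-] [C BC Cp]] sUBA].
rewrite nbhs_filterE; apply: filterS sUBA _; apply: (@filterS _ _ _ C).
  by move=> x Cx; exists C.
have /sB [D sD IDeC] := BC; rewrite -IDeC; apply: filter_bigI => E DE.
have := sD _ DE; rewrite inE => -[t It EV].
have Ep : E p by move: Cp; rewrite -IDeC => /(_ _ DE).
by case: EV Ep => -> Ep; [exact: Fle|exact: Fnle].
Qed.

Hypothesis treeT : omega1_tree T.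

Lemma root_exists : exists o : T, forall t, (o <= t)%O.
Proof.
have [|o [_ lo]] := chain_sup treeT (C := set0); first by move=> ? ? [].
by exists o => t; apply: lo => ? [].
Qed.

Lemma Vset_chain s t x : (s <= x)%O -> (t <= x)%O -> (s <= t)%O \/ (t <= s)%O.
Proof. by move=> sx tx; apply/orP; exact: (comparable_below treeT sx tx). Qed.

Lemma below_chain t : total_on (below t) (fun s s' => (s <= s')%O).
Proof. by move=> s s' /ltW st /ltW s't; exact: Vset_chain st s't. Qed.

(** A least [r] below [p] but not below [q] is isolated: otherwise it would be
    the supremum of its strict predecessors, which all lie below [q]. *)
Lemma separating_node p q : ~ (p <= q)%O ->
  exists r, [/\ Iset r, (r <= p)%O & ~ (r <= q)%O].
Proof.
move=> npq.
have [r [rp nrq] minr] : exists2 r, (r <= p)%O /\ ~ (r <= q)%O &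
    forall v, (v < r)%O -> ~ ((v <= p)%O /\ ~ (v <= q)%O).
  by apply: (well_founded_least (lt_wf treeT)); exists p.
exists r; split=> //; apply/(IsetE treeT).
have [w [wub wleast]] := chain_sup treeT (@below_chain r).
have wr : (w <= r)%O by apply: wleast => s /ltW.
have wq : (w <= q)%O.
  apply: wleast => s ls; apply: contrapT => nsq; apply: (minr s ls); split=> //.
  exact: le_trans (ltW ls) rp.
right; exists w; last exact: wub.
by rewrite lt_neqAle wr andbT; apply/eqP => e; apply: nrq; rewrite -e.
Qed.

Lemma hausdorff_wedge : hausdorff_space (coarse_wedge T).
Proof.
have sep p q : cluster (nbhs (p : coarse_wedge T)) q -> (p <= q)%O /\ (q <= p)%O.
  move=> pq; split; apply: contrapT => /separating_node[r [Ir rle nrle]].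
  - have [] := pq (Vset r) (~` Vset r).
    + by apply: open_nbhs_nbhs; split=> //; exact: open_Vset.
    + by apply: open_nbhs_nbhs; split=> //; exact: open_VsetC.
    + by move=> x [].
  - have [] := pq (~` Vset r) (Vset r).
    + by apply: open_nbhs_nbhs; split=> //; exact: open_VsetC.
    + by apply: open_nbhs_nbhs; split=> //; exact: open_Vset.
    + by move=> x [].
by move=> p q /sep[pq qp]; apply/eqP; rewrite eq_le pq qp.
Qed.

(** Otherwise the chain would be bounded by the greatest strict predecessor of
    [q]. *)
Lemma isolated_below_sup (C : set T) p q :
  C !=set0 -> supremums C p -> Iset q -> (q <= p)%O ->
  exists2 c, C c & (q <= c)%O.
Proof.
move=> [c0 Cc0] [pub pleast] Iq qp; apply: contrapT => noc.
have Clt c : C c -> (c < q)%O.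
  move=> Cc; have [cq|qc] := Vset_chain (pub _ Cc) qp.
    rewrite lt_neqAle cq andbT; apply/eqP => e; apply: noc.
    by exists c => //; rewrite e.
  by case: noc; exists c.
case/(IsetE treeT): Iq => [q0|[m mq maxm]].
- by have : below q c0 by [exact: Clt]; rewrite q0.
- have : (p <= m)%O by apply: pleast => c /Clt/maxm.
  by move=> /(le_trans qp)/le_lt_trans/(_ mq); rewrite ltxx.
Qed.

(** An ultrafilter converges to the supremum of the chain of those [s] whose
    wedge it contains. *)
Lemma compact_wedge : compact [set: coarse_wedge T].
Proof.
rewrite compact_ultra => F FU _.
have FF := @ultra_proper _ _ FU.
pose C : set T := [set s | F (Vset s)].
have Cchain : total_on C (fun s s' => (s <= s')%O).
  by move=> s s' Cs Cs'; have [x [sx s'x]] := filter_ex (filterI Cs Cs');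
    exact: Vset_chain sx s'x.
have [p supp] := chain_sup treeT Cchain.
exists p; split=> //; apply: wedge_cvg => [q Iq qp|q Iq nqp].
- have [|c Cc qc] := isolated_below_sup _ supp Iq qp.
    have [o leo] := root_exists; exists o.
    have -> : C o = F setT; last exact: filterT.
    by congr F; apply/seteqP; split=> // x _; exact: leo.
  by apply: (filterS _ Cc) => x cx; exact: le_trans cx.
- have [Vq|//] := in_ultra_setVsetC (Vset q) FU.
  by case: nqp; case: supp => + _; exact.
Qed.

Lemma below_succ_countable t : Iset t -> countable_node t.
Proof.
move=> /(IsetE treeT)[t0|[p pt maxp]]; rewrite /countable_node ?t0//.
apply: (@sub_countable _ _ _ (below p `|` [set p])).
  by apply: subset_card_le => s /maxp; rewrite le_eqVlt => /orP[/eqP->|];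
    [right|left].
by apply: countable_setU => //; exact: countable_below pt.
Qed.

Lemma uncountable_node_max t x : ~ countable_node t -> (t <= x)%O -> x = t.
Proof.
move=> nct; rewrite le_eqVlt => /orP[/eqP//|/(countable_below treeT)].
by move=> /nct.
Qed.

Lemma increasing_seq (rs : nat -> T) : (forall n, (rs n < rs n.+1)%O) ->
  forall m n, (m <= n)%N -> (rs m <= rs n)%O.
Proof.
move=> rslt; apply: (homo_leq (r := fun s t : T => (s <= t)%O)) => [//|y x z|n].
  exact: le_trans.
exact/ltW.
Qed.

Lemma increasing_chain (rs : nat -> T) : (forall n, (rs n < rs n.+1)%O) ->
  total_on (range rs) (fun s s' => (s <= s')%O).
Proof.
move=> /increasing_seq rsmono _ _ [m _ <-] [n _ <-].
by have [mn|/ltnW nm] := leqP m n; [left|right]; exact: rsmono.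
Qed.

Lemma sup_countable_node (C : set T) p :
  total_on C (fun s s' => (s <= s')%O) -> supremums C p -> countable C ->
  (forall c, C c -> countable_node c) -> countable_node p.
Proof.
move=> totC [pub pleast] cC Cc.
apply: (@sub_countable _ _ _ (\bigcup_(c in C) (below c `|` [set c]))).
  apply: subset_card_le => s sp.
  have [c Ccc ncs] : exists2 c, C c & ~ (c <= s)%O.
    apply: contrapT => noc; suff /(lt_le_trans sp) : (p <= s)%O by rewrite ltxx.
    by apply: pleast => c Ccc; apply: contrapT => ncs; apply: noc; exists c.
  exists c => //; have [//|] := Vset_chain (pub _ Ccc) (ltW sp).
  by rewrite le_eqVlt => /orP[/eqP->|]; [right|left].
apply: bigcup_countable => // c /Cc cc; exact: countable_setU.
Qed.

(** The wedges of the isolated nodes strictly below a node of height [omega1]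
    form a neighbourhood base at that node, because only the node itself lies
    above it. *)
Lemma uncountable_node_nbhs (t : T) (U : set (coarse_wedge T)) :
  ~ countable_node t -> nbhs (t : coarse_wedge T) U ->
  exists r : T, [/\ Iset r, (r < t)%O & Vset r `<=` U].
Proof.
move=> nct.
have ltt r : Iset r -> (r <= t)%O -> (r < t)%O.
  move=> Ir rt; rewrite lt_neqAle rt andbT; apply/eqP => e; apply: nct.
  by rewrite -e; exact: below_succ_countable.
have ntle q : q <> t -> ~ (t <= q)%O.
  by move=> nq /(uncountable_node_max nct).
pose D := [set r : T | Iset r /\ (r < t)%O].
pose F : set_system (coarse_wedge T) := filter_from D (@Vset d T).
have FF : Filter F.
  apply: filter_from_filter.
    have [s st] : below t !=set0.
      by apply/set0P/eqP => t0; apply: nct; rewrite /countable_node t0.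
    have nts : ~ (t <= s)%O by move=> /(lt_le_trans st); rewrite ltxx.
    have [r [Ir rt _]] := separating_node nts.
    by exists r; split=> //; exact: ltt.
  move=> r r' [Ir rt] [Ir' r't].
  have [rr'|r'r] := Vset_chain (ltW rt) (ltW r't).
  - by exists r' => // x r'x; split=> //; exact: le_trans r'x.
  - by exists r => // x rx; split=> //; exact: le_trans rx.
have Ft : F --> (t : coarse_wedge T).
  apply: wedge_cvg => [q Iq qt|q Iq nqt].
    by exists q => //; split=> //; exact: ltt.
  have [|r [Ir rt nrq]] := @separating_node t q.
    by apply: ntle => e; apply: nqt; rewrite e.
  exists r; first by split=> //; exact: ltt.
  move=> x rx qx; have [//|qr] := Vset_chain rx qx.
  by apply: nqt; exact: le_trans rt.
by move=> /Ft[r [Ir rt] sVU]; exists r.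
Qed.

End WedgeTopology.

(** * Cubes and Valdivia compacta *)

Section Cubes.
Context (R : realType) (G : Type).

Lemma cube_cvgP (F : set_system (cube R G)) (x : cube R G) : Filter F ->
  F --> x <-> forall g, (fun y : cube R G => y g) @ F --> x g.
Proof.
move=> FF; rewrite /cube/=; split.
- move=> /cvg_sup + g A nA => /(_ g) Fx.
  have := @initial_continuous _ _ (fun y : cube R G => y g) x A nA.
  exact: Fx.
- move=> Fx; apply/cvg_sup => g A [_ [[B oB <-] Bx sBA]].
  apply: filterS sBA _; apply: (Fx g); exact: open_nbhs_nbhs.
Qed.

Lemma cube_eval_continuous (g : G) : continuous (fun x : cube R G => x g).
Proof. by move=> x; have /cube_cvgP := @cvg_id _ (nbhs x); exact. Qed.

Lemma hausdorff_set_type (X : topologicalType) (A : set X) :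
  hausdorff_space X -> hausdorff_space (set_type A).
Proof.
move=> hX p q pq; apply: val_inj; apply: hX => U V nU nV.
have [x [Ux Vx]] := pq _ _ (initial_continuous nU) (initial_continuous nV).
by exists (val x).
Qed.

Lemma hausdorff_cube : hausdorff_space (cube R G).
Proof.
move=> p q pq; apply: functional_extensionality_dep => g.
apply: (hausdorff_set_type (@norm_hausdorff R R)) => U V nU nV.
have [x [Ux Vx]] :=
  pq _ _ (cube_eval_continuous nU) (cube_eval_continuous nV).
by exists (x g).
Qed.

End Cubes.

Lemma compact_space_closed (X : topologicalType) (A : set X) :
  compact_space X -> closed A -> compact_space (set_type A).
Proof.
move=> [hX cX] clA; split; first exact: hausdorff_set_type.
move=> F FF _.
have [//|p [_ clp]] := cX (set_val @ F) _; first exact: filterT.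
have Ap : A p.
  rewrite (closure_id A).1 // => V nV; apply: clp => //.
  by apply: nearW => x; exact: set_valP.
exists (exist _ p (mem_set Ap)); split=> // B D FB [_ [[C oC <-] Cp sCD]].
have [] := clp (set_val @` B) C.
- exact: (filterS (@preimage_image _ _ set_val B) FB).
- exact: open_nbhs_nbhs.
- by move=> _ [[x Bx <-] Cx]; exists x; split=> //; exact: sCD.
Qed.

Lemma compact_homeo_embedding (X Y : topologicalType) (h : X -> Y) :
  compact [set: X] -> hausdorff_space Y -> injective h -> continuous h ->
  homeo_embedding h.
Proof.
move=> cX hY hinj hcont; split=> // U oU.
exists (~` (h @` (~` U))).
  rewrite openC; apply: compact_closed => //.
  apply: continuous_compact; first exact: continuous_subspaceT.
  by apply: subclosed_compact cX _ => //; rewrite closedC.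
apply/seteqP; split=> [x Ux [y nUy /hinj yx]|x nx].
  by apply: nUy; rewrite yx.
by apply: contrapT => nUx; apply: nx; exists x.
Qed.

(** The characteristic functions of the sets [W g] are the coordinates of the
    embedding; the support of the image of [x] is the set of the [g] such that
    [W g] contains [x]. *)
Lemma valdivia_of_clopens (R : realType) (K : topologicalType) (G : Type)
    (W : G -> set K) :
  compact_space K -> (forall g, open (W g)) -> (forall g, closed (W g)) ->
  (forall x y, (forall g, W g x <-> W g y) -> x = y) ->
  dense [set x | countable [set g | W g x]] ->
  valdivia R K.
Proof.
move=> cK oW cW sepW dW; split=> //.
have i01 (b : bool) : @unit_itv R (b%:R)%R.
  by rewrite /unit_itv /= in_itv /= ler0n lern1 leq_b1.
pose e (b : bool) : set_type (@unit_itv R) := exist _ (b%:R)%R (mem_set (i01 b)).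
pose h (x : K) : cube R G := fun g => e `[< W g x >].
have hE x g : (set_val (h x g) <> 0)%R <-> W g x.
  rewrite /h /e set_valE /=; case: asboolP => Wx; split=> //.
  by move=> _; apply/eqP; rewrite oner_eq0.
exists G, h; split; last first.
  move=> O O0 oO; have [x [Ox cx]] := dW O O0 oO; exists x; split=> //.
  by apply: sub_countable cx; apply: subset_card_le => g /hE.
case: (cK) => _ compK.
apply: compact_homeo_embedding => //; first exact: hausdorff_cube.
- move=> x y hxy; apply: sepW => g; rewrite -!hE hxy; exact: iff_refl.
- move=> x; apply/cube_cvgP => g U nU.
  have near_h (V : set K) : open V -> V x ->
      (forall y, V y -> h y g = h x g) -> nbhs x (fun y => U (h y g)).
    move=> oV Vx hV; apply: filterS (open_nbhs_nbhs (conj oV Vx)) => y Vy.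
    by rewrite hV //; exact: nbhs_singleton.
  have [Wx|nWx] := pselect (W g x).
  + by apply: (near_h (W g)) => // y Wy; rewrite /h !asboolT.
  + apply: (near_h (~` W g)) => //; first by rewrite openC.
    by move=> y nWy; rewrite /h !asboolF.
Qed.

Lemma weakly_valdivia_of_valdivia (R : realType) (K : topologicalType) :
  valdivia R K -> weakly_valdivia R K.
Proof.
move=> vK; split; first by case: vK.
exists K => //; exists id; first by move=> x; exact: cvg_id.
by apply/seteqP; split=> // x _; exists x.
Qed.

(** * Closed subsets of the tree *)

Section ClosedSubsets.
Context {d : Order.disp_t} (T : porderType d).
Hypothesis treeT : omega1_tree T.
Implicit Types (p q r s t : T).

(** Consider a wedge that meets a closed set [F] in nodes of height [omega1]
    only.  If a point [t] of it were not cut out by a smaller wedge, one could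
    choose isolated nodes [rs 0 < rs 1 < ...] below [t] and points [es n] of [F]
    that branch off from [t] between [rs n] and [rs n.+1].  The supremum of the
    [rs n] has countable height and is the limit of the [es n], hence lies in
    [F]. *)
Lemma wedge_isolates_uncountable_node (F : set (coarse_wedge T)) r t :
  closed F -> Iset r -> (forall x : T, F x -> (r <= x)%O -> ~ countable_node x) ->
  (r <= t)%O -> F t ->
  exists r', [/\ Iset r', (r' <= t)%O &
    forall x : T, F x -> (r' <= x)%O -> x = t].
Proof.
move=> clF Ir runc rt Ft; apply: contrapT => nor'.
have step s : exists n : T * T, Iset s -> (s <= t)%O ->
    [/\ Iset n.1 /\ (n.1 <= t)%O, (s < n.1)%O, F n.2, (s <= n.2)%O
      & ~ (n.1 <= n.2)%O].
  have [[Is st]|nst] := pselect (Iset s /\ (s <= t)%O); last first.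
    by exists (s, s) => Is st; case: nst.
  have [e [Fe se net]] : exists e : T, [/\ F e, (s <= e)%O & e <> t].
    apply: contrapT => noe; apply: nor'; exists s; split=> // x Fx sx.
    by apply: contrapT => nxt; apply: noe; exists x.
  have nte : ~ (t <= e)%O.
    by move=> /(uncountable_node_max treeT (runc _ Ft rt)).
  have [n [In nt nne]] := separating_node treeT nte.
  exists (n, e) => _ _; split=> //=.
  have [ns|] := Vset_chain treeT nt st; first by case: nne; exact: le_trans se.
  by rewrite le_eqVlt => /orP[/eqP e'|//]; case: nne; rewrite -e'.
have [f fE] := choice step.
pose rs n := iter n (fun s => (f s).1) r; pose es n := (f (rs n)).2.
have rsE n : Iset (rs n) /\ (rs n <= t)%O.
  by elim: n => [//|n [In nt]]; case: (fE _ In nt).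
have rslt n : (rs n < rs n.+1)%O by have [In nt] := rsE n; case: (fE _ In nt).
have Fes n : F (es n) by have [In nt] := rsE n; case: (fE _ In nt).
have rses n : (rs n <= es n)%O by have [In nt] := rsE n; case: (fE _ In nt).
have nrses n : ~ (rs n.+1 <= es n)%O.
  by have [In nt] := rsE n; case: (fE _ In nt).
have rsmono := increasing_seq rslt.
have chainrs := increasing_chain rslt.
have [p supp] := chain_sup treeT chainrs.
have [pub pleast] := supp.
have rsp n : (rs n <= p)%O by apply: pub; exists n.
have pt : (p <= t)%O by apply: pleast => _ [n _ <-]; case: (rsE n).
have cp : countable_node p.
  apply: (sup_countable_node treeT chainrs supp).
    apply: sub_countable (card_image_le _ _) _; exact: countableP.
  by move=> _ [n _ <-]; exact: below_succ_countable (rsE n).1.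
suff Fp : F p by exact: runc _ Fp (rsp 0%N) cp.
have esp : (es : nat -> coarse_wedge T) @ \oo --> (p : coarse_wedge T).
  apply: wedge_cvg => [q Iq qp|q Iq nqp].
    have [|_ [n _ <-] qn] := isolated_below_sup treeT _ supp Iq qp.
      by exists (rs 0%N); exists 0%N.
    exists n => // m /= nm; apply: le_trans (rses m); apply: le_trans qn _.
    exact: rsmono.
  have [[n qen]|noN] := pselect (exists n, (q <= es n)%O); last first.
    by exists 0%N => // n _ qen; apply: noN; exists n.
  exists n.+1 => // m /= nm qem.
  have rnem : (rs n.+1 <= es m)%O by apply: le_trans (rses m); exact: rsmono.
  have [qrn|rnq] := Vset_chain treeT qem rnem.
    by apply: nqp; exact: le_trans (rsp n.+1).
  by apply: (nrses n); exact: le_trans qen.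
apply: (@closed_cvg _ (coarse_wedge T) _ _ es F clF _ p esp).
by exists 0%N => // n _; exact: Fes.
Qed.

(** The family [W] of clopen subsets of [F] consists of the traces of the wedges
    [Vset r] that contain a node of countable height in [F] ([rich r]), and of
    the singletons of the points of uncountable height isolated in [F]
    ([lonely]).  A node of countable height belongs to countably many members
    of [W]; so does a lonely point, because the rich [r] below it lie below a
    node whose wedge meets [F] in it alone.  By
    [wedge_isolates_uncountable_node], a wedge that is not rich contains lonely
    points only; hence [W] separates points, and every remaining point of
    uncountable height is a limit of nodes of countable height in [F]. *)
Lemma closed_valdivia (R : realType) (F : set (coarse_wedge T)) :
  closed F -> valdivia R (set_type F).
Proof.
move=> clF.
have cF : compact_space (set_type F).
  apply: compact_space_closed clF; split.
    exact: hausdorff_wedge treeT.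
  exact: compact_wedge treeT.
pose node (x : set_type F) : T := val x.
have Fnode x : F (node x) by exact: set_valP.
pose fromF (x : T) (Fx : F x) : set_type F := exist _ x (mem_set Fx).
pose lonely (x : set_type F) := ~ countable_node (node x) /\ open [set x].
pose rich r := exists2 x : T, F x & (r <= x)%O /\ countable_node x.
pose W r := [set x | (Iset r /\ rich r) /\ (r <= node x)%O] `|`
            [set x | node x = r /\ lonely x].
have preim_open (U : set (coarse_wedge T)) : open U -> open (node @^-1` U).
  by move=> oU; exists U.
have clo_wedge r : open [set x | (Iset r /\ rich r) /\ (r <= node x)%O] /\
    closed [set x | (Iset r /\ rich r) /\ (r <= node x)%O].
  have [c|nc] := pselect (Iset r /\ rich r); last first.
    rewrite (_ : mkset _ = set0); first by split; [exact: open0|exact: closed0].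
    by apply/seteqP; split=> // x [].
  have -> : [set x | (Iset r /\ rich r) /\ (r <= node x)%O] =
      node @^-1` (Vset r) by apply/seteqP; split=> [x []|x].
  split; first by apply: preim_open; exact: open_Vset c.1.
  by rewrite -openC; exact: (preim_open _ (open_VsetC c.1)).
have clo_point r : open [set x | node x = r /\ lonely x] /\
    closed [set x | node x = r /\ lonely x].
  have [[x [xr lx]]|nx] := pselect (exists x, node x = r /\ lonely x); last first.
    rewrite (_ : mkset _ = set0); first by split; [exact: open0|exact: closed0].
    by apply/seteqP; split=> // x [xr lx]; apply: nx; exists x.
  have -> : [set x | node x = r /\ lonely x] = [set x].
    apply/seteqP; split=> [y [yr _]|_ ->//].
    by apply: val_inj; rewrite -[LHS]/(node y) -[RHS]/(node x) yr xr.
  split; first exact: lx.2.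
  by apply: accessible_closed_set1; apply: hausdorff_accessible; exact: cF.1.
have poor_lonely r x : Iset r -> (r <= node x)%O -> ~ rich r -> lonely x.
  move=> Ir rx nrich.
  have runc (y : T) : F y -> (r <= y)%O -> ~ countable_node y.
    by move=> Fy ry cy; apply: nrich; exists y.
  split; first exact: runc.
  have [r' [Ir' r'x only]] :=
    wedge_isolates_uncountable_node clF Ir runc rx (Fnode x).
  have -> : [set x] = node @^-1` (Vset r').
    by apply/seteqP; split=> [_ ->//|y r'y]; apply: val_inj; exact: only.
  by apply: preim_open; exact: open_Vset.
have lonely_not_Iset x : lonely x -> ~ Iset (node x).
  by move=> [nc _] /(below_succ_countable treeT).
have lonelyW x y : lonely x -> (forall r, W r x <-> W r y) -> x = y.
  move=> lx xy; have /xy : W (node x) x by right.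
  move=> [[[/(lonely_not_Iset _ lx)]]//|[yx _]].
  by apply: val_inj.
have sepW x y : (forall r, W r x <-> W r y) -> (node x <= node y)%O.
  move=> xy; have [/lonelyW/(_ xy)->//|nlx] := pselect (lonely x).
  have [/lonelyW/(_ (fun r => iff_sym (xy r)))->//|nly] := pselect (lonely y).
  apply: contrapT => /(separating_node treeT)[r [Ir rx nry]].
  have /xy : W r x.
    left; split=> //; split=> //; apply: contrapT => nr.
    exact: nlx (poor_lonely _ _ Ir rx nr).
  by move=> [[_ /nry]|[_ /nly]].
have cW x : countable_node (node x) -> countable [set r | W r x].
  move=> cx; apply: (@sub_countable _ _ _ (below (node x) `|` [set node x])).
    apply: subset_card_le => r [[_]|[-> _]]; last by right.
    by rewrite le_eqVlt => /orP[/eqP->|]; [right|left].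
  exact: countable_setU.
apply: (@valdivia_of_clopens R _ T W) => //.
- by move=> r; apply: openU; [case: (clo_wedge r)|case: (clo_point r)].
- by move=> r; apply: closedU; [case: (clo_wedge r)|case: (clo_point r)].
- move=> x y xy; apply: val_inj; apply/eqP; rewrite eq_le.
  by apply/andP; split; apply: sepW => // r; exact: iff_sym.
move=> O [x Ox] oO.
have [cx|ncx] := pselect (countable_node (node x)).
  by exists x; split=> //; exact: cW.
have [lx|nlx] := pselect (lonely x).
- exists x; split=> //.
  case: (lx) => _ [U oU Ux].
  have Unode : U (node x) by have : [set x] x by []; rewrite -[X in X _]Ux.
  have [r' [Ir' r'x r'U]] :=
    uncountable_node_nbhs treeT ncx (open_nbhs_nbhs (conj oU Unode)).
  have only (y : T) : F y -> (r' <= y)%O -> y = node x.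
    move=> Fy /r'U Uy; have : [set x] (fromF y Fy) by rewrite -Ux.
    by move=> <-.
  apply: (@sub_countable _ _ _ (below r' `|` [set node x])).
    apply: subset_card_le => r [[[Ir [y Fy [ry cy]]] rx]|[-> _]]; last by right.
    left; have [rr'|r'r] := Vset_chain treeT rx (ltW r'x).
      rewrite /below /= lt_neqAle rr' andbT; apply/eqP => e.
      by apply: ncx; rewrite -(only y) // -e.
    by case: ncx; rewrite -(only y) //; exact: le_trans ry.
  apply: countable_setU => //; exact: below_succ_countable Ir'.
- case: oO => U oU UO.
  have Ux : U (node x) by have := Ox; rewrite -UO.
  have [r [Ir rx rU]] :=
    uncountable_node_nbhs treeT ncx (open_nbhs_nbhs (conj oU Ux)).
  have [y Fy [ry cy]] : rich r.
    apply: contrapT => nr; exact: nlx (poor_lonely _ _ Ir (ltW rx) nr).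
  exists (fromF y Fy); split; last exact: cW.
  by rewrite -UO; exact: rU.
Qed.

End ClosedSubsets.

(** * Countably compact subsets of Sigma-products *)

Section SigmaProducts.
Context (R : realType) (G : Type).

Definition supp (x : cube R G) : set G := [set g | (set_val (x g) <> 0)%R].

Lemma open_supp (g : G) : open [set x : cube R G | supp x g].
Proof.
rewrite (_ : mkset _ = (fun x : cube R G => x g) @^-1`
    (set_val @^-1` (~` [set 0%R]))) //.
apply: open_comp; first by move=> x _; exact: cube_eval_continuous.
exists (~` [set 0%R]) => //; rewrite openC.
by apply: accessible_closed_set1; apply: hausdorff_accessible;
  exact: norm_hausdorff.
Qed.

(** Points supported in a fixed countable set form a subspace of a countable
    product of intervals; finite lists of rational bounds on coordinates
    describe a countable base of it. *)
Lemma separable_countable_support (N : set G) (S : set (cube R G)) :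
  countable N -> (forall x, S x -> supp x `<=` N) ->
  exists D : set (cube R G), [/\ countable D, D `<=` S & S `<=` closure D].
Proof.
move=> /countable_injP[e einj] SN.
have [[x0 Sx0]|S0] := pselect (S !=set0); last first.
  by exists set0; split=> // x Sx; case: S0; exists x.
pose B (l : seq (nat * rat * rat)) : set (cube R G) :=
  [set x | S x /\ forall c, c \in l -> forall g, N g -> e g = c.1.1 ->
    (ratr c.1.2 < set_val (x g) < ratr c.2)%R].
have /choice[y yB] l : exists y, B l !=set0 -> B l y.
  by have [[y By]|nB] := pselect (B l !=set0); [exists y|exists x0].
exists [set y l | l in [set l | B l !=set0]]; split.
- apply: sub_countable (card_image_le _ _) _; exact: countableP.
- by move=> _ [l Bl <-]; case: (yB _ Bl).
move=> x Sx.
pose F : set_system (cube R G) := filter_from [set l | B l x] B.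
have FF : Filter F.
  apply: filter_from_filter; first by exists [::].
  move=> l l' [_ lx] [_ l'x]; exists (l ++ l').
    by split=> // c; rewrite mem_cat => /orP[/lx|/l'x].
  move=> z [Sz lz]; split; split=> // c cl; apply: lz;
    by rewrite mem_cat cl ?orbT.
have Fx : F --> x.
  apply/cube_cvgP => g U [_ [[V oV <-] Vx sVU]].
  have [Ng|nNg] := pselect (N g); last first.
    exists [::] => // z [Sz _]; apply: sVU.
    have zero (w : cube R G) : S w -> (set_val (w g) = 0)%R.
      by move=> Sw; apply: contrapT => /(SN _ Sw).
    by rewrite /= zero //; move: Vx; rewrite /= zero.
  pose v : R := set_val (x g).
  have /nbhs_ballP[r /= r0 rV] : nbhs v V by exact: open_nbhs_nbhs.
  have [a] : exists q : rat, ratr q \in `](v - r)%R, v[%R.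
    by apply: rat_in_itvoo; rewrite ltrBlDr ltrDl.
  rewrite in_itv /= => /andP[ra av].
  have [b] : exists q : rat, ratr q \in `]v, (v + r)%R[%R.
    by apply: rat_in_itvoo; rewrite ltrDl.
  rewrite in_itv /= => /andP[vb br].
  exists [:: (e g, a, b)].
    split=> // c; rewrite inE => /eqP -> /= g' Ng' /einj gg'.
    by rewrite gg' ?inE // -/v av vb.
  move=> z [Sz /(_ (e g, a, b))]; rewrite inE eqxx => /(_ isT g Ng erefl) /=.
  move=> /andP[az zb]; apply: sVU; apply: rV.
  rewrite /ball /= ltr_distlC (lt_trans ra az) /=.
  exact: lt_trans br.
move=> U /Fx[l Bx sBU]; have Bl : B l !=set0 by exists x.
by exists (y l); split; [exists l|apply: sBU; exact: yB].
Qed.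

End SigmaProducts.

(** If no cluster point existed, the complements of the closures of the tails
    would form a countable open cover. *)
Lemma countably_compact_cluster (X : topologicalType) (u : nat -> X) :
  countably_compact_space X ->
  exists y : X, forall U : set X, nbhs y U ->
    forall n, exists2 m, (n <= m)%N & U (u m).
Proof.
move=> ccX; apply: contrapT => noy.
pose tail n : set X := [set u m | m in [set m | (n <= m)%N]].
have [|||D _ cov] := ccX nat setT (fun n => ~` closure (tail n)).
- exact: countableP.
- by move=> n _; rewrite openC; exact: closed_closure.
- move=> y _; apply: contrapT => ncov; apply: noy; exists y => U nU n.
  have cly : closure (tail n) y by apply: contrapT => ncl; apply: ncov; exists n.
  by have [_ [[m nm <-] Um]] := cly U nU; exists m.
have [n Dn nu] := cov (u (\max_(n <- enum_fset D) n)) Logic.I.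
apply: nu; apply: subset_closure; exists (\max_(n <- enum_fset D) n) => //=.
exact: (@leq_bigmax_seq _ _ xpredT id n Dn).
Qed.

(** * The tree is not weakly Corson *)

Section NotWeaklyCorson.
Context {d : Order.disp_t} (T : porderType d).
Hypotheses (treeT : omega1_tree T) (branchT : splits_countable_nodes T).
Implicit Types (s t u v : T).

(** Going up [s], one avoids the elements of [E] one at a time: of two
    incompatible nodes above the current one, at most one lies below the given
    element.  The supremum of the resulting sequence has countable height. *)
Lemma avoid_countable (E : set T) s : countable E -> countable_node s ->
  exists s', [/\ Iset s', (s < s')%O, countable_node s'
    & forall e, E e -> ~ (s' <= e)%O].
Proof.
move=> /countable_injP[j jinj] cs.
have step (sn : T * nat) : exists s', countable_node sn.1 ->
    [/\ (sn.1 < s')%O, countable_node s'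
      & forall e, E e -> j e = sn.2 -> ~ (s' <= e)%O].
  case: sn => t n /=.
  have [ct|nct] := pselect (countable_node t); last by exists t.
  have [u [v [tu tv cu cv uv]]] := branchT ct.
  have [[e Ee [jen ue]]|noe] :=
      pselect (exists2 e, E e & j e = n /\ (u <= e)%O).
    exists v => _; split=> // e' Ee' je'.
    have -> : e' = e by apply: jinj; rewrite ?inE // je' jen.
    by move=> ve; exact: uv (conj ue ve).
  by exists u => _; split=> // e Ee jen ue; apply: noe; exists e.
have [f fE] := choice step.
pose rs := fix rs n := if n is m.+1 then f (rs m, m) else s.
have crs n : countable_node (rs n).
  by elim: n => [//|n IH]; case: (fE (rs n, n) IH).
have rslt n : (rs n < rs n.+1)%O by case: (fE (rs n, n) (crs n)).
have rse n e : E e -> j e = n -> ~ (rs n.+1 <= e)%O.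
  by case: (fE (rs n, n) (crs n)) => _ _; exact.
have chainrs := increasing_chain rslt.
have [p supp] := chain_sup treeT chainrs.
have cp : countable_node p.
  apply: (sup_countable_node treeT chainrs supp).
    apply: sub_countable (card_image_le _ _) _; exact: countableP.
  by move=> _ [n _ <-].
have [u [_ [pu _ _ _ _]]] := branchT cp.
have nup : ~ (u <= p)%O by move=> /(lt_le_trans pu); rewrite ltxx.
have [r [Ir ru nrp]] := separating_node treeT nup.
have pr : (p < r)%O.
  have [rp|//] := Vset_chain treeT ru (ltW pu); first by case: nrp.
  by rewrite le_eqVlt => /orP[/eqP pr|//]; case: nrp; rewrite pr.
have rsp n : (rs n <= p)%O by case: supp => + _; apply; exists n.
exists r; split=> //.
- exact: le_lt_trans (rsp 0%N) pr.
- exact: below_succ_countable.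
- move=> e Ee re; apply: (rse (j e) e Ee erefl).
  exact: le_trans (rsp _) (le_trans (ltW pr) re).
Qed.

Section Image.
Context (R : realType) (G : Type) (A : set (cube R G)).
Hypothesis AS : A `<=` @Sigma R G.
Hypothesis ccA : countably_compact_space (set_type A).
Variable f : set_type A -> coarse_wedge T.
Hypothesis fcont : continuous f.
Hypothesis fsurj : range f = [set: coarse_wedge T].

Definition sp (x : set_type A) : set G := supp (val x).
Definition node (x : set_type A) : T := f x.

Lemma sp_countable x : countable (sp x).
Proof. exact: AS (set_valP x). Qed.

(** The points supported in [N] have a countable dense subset, so an open wedge
    that its image misses contains no image of a point supported in [N]. *)
Lemma avoid_support (N : set G) s : countable N -> countable_node s ->
  exists s', [/\ Iset s', (s < s')%O, countable_node s'
    & forall x, sp x `<=` N -> ~ (s' <= node x)%O].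
Proof.
move=> cN cs.
pose S := [set x : cube R G | A x /\ supp x `<=` N].
have [D [cD DS SD]] : exists D : set (cube R G),
    [/\ countable D, D `<=` S & S `<=` closure D].
  by apply: (separable_countable_support cN) => x [].
pose E := node @` (set_val @^-1` D).
have cE : countable E.
  apply: sub_countable (card_image_le _ _) _.
  apply: (countable_inj_on (f := set_val) _ _ cD) => // x y _ _.
  exact: val_inj.
have [s' [Is' ss' cs' nE]] := avoid_countable cE cs.
exists s'; split=> // x xN s'x.
have [O oO Of] : open (f @^-1` Vset s').
  apply: open_comp; first by move=> z _; exact: fcont.
  exact: open_Vset.
have Ox : O (val x) by have : (f @^-1` Vset s') x by []; rewrite -Of.
have [y [Dy Oy]] : D `&` O !=set0.
  apply: (SD (val x)); first by split=> //; exact: set_valP.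
  exact: open_nbhs_nbhs.
have Ay : A y by have [] := DS _ Dy.
pose y' : set_type A := exist _ y (mem_set Ay).
apply: (nE (node y')); first by exists y'.
suff : (f @^-1` Vset s') y' by [].
by rewrite -Of.
Qed.

(** If no countable [M] worked, one could choose points over the wedge [s']
    with supports pairwise disjoint off [N]; a cluster point of them would be
    supported in [N]. *)
Lemma new_coordinates (N : set G) s : countable N -> countable_node s ->
  exists s' (M : set G), [/\ (s < s')%O, countable_node s', countable M, N `<=` M
    & forall x, (s' <= node x)%O -> exists2 g, sp x g & M g /\ ~ N g].
Proof.
move=> cN cs; have [s' [Is' ss' cs' avoid]] := avoid_support cN cs.
exists s'; apply: contrapT => noM.
have [x0 _ _] : range f s by rewrite fsurj.
have step (M : set G) : exists x, countable M -> N `<=` M ->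
    (s' <= node x)%O /\ forall g, sp x g -> M g -> N g.
  have [[cM NM]|nM] := pselect (countable M /\ N `<=` M); last first.
    by exists x0 => cM NM; case: nM.
  apply: contrapT => nox; apply: noM; exists M; split=> // x s'x.
  apply: contrapT => nog; apply: nox; exists x => _ _; split=> // g xg Mg.
  by apply: contrapT => nNg; apply: nog; exists g.
have [phi phiE] := choice step.
pose M := fix M n := if n is m.+1 then M m `|` sp (phi (M m)) else N.
have cM n : countable (M n).
  by elim: n => [//|n IH] /=; apply: countable_setU => //; exact: sp_countable.
have Mmono m n : (m <= n)%N -> M m `<=` M n.
  elim: n => [|n IH]; first by rewrite leqn0 => /eqP->.
  by rewrite leq_eqVlt => /orP[/eqP->//|/IH MmMn] g /MmMn; left.
have NM n : N `<=` M n by exact: (Mmono 0%N n).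
have [y yclust] := countably_compact_cluster (phi \o M) ccA.
apply: (avoid y).
- move=> g yg; apply: contrapT => nNg.
  have nO : nbhs y [set x : set_type A | sp x g].
    apply: open_nbhs_nbhs; split=> //.
    by exists [set x : cube R G | supp x g] => //; exact: open_supp.
  have [m _ gm] := yclust _ nO 0%N.
  have [n mn gn] := yclust _ nO m.+1.
  have [_ only] := phiE _ (cM n) (NM n).
  by apply/nNg/(only g gn)/(Mmono _ _ mn); right.
- apply: contrapT => nys.
  have nO : nbhs y (f @^-1` (~` Vset s')).
    by apply: fcont; apply: open_nbhs_nbhs; split=> //; exact: open_VsetC.
  have [m _ gm] := yclust _ nO 0%N; apply: gm.
  by have [] := phiE _ (cM m) (NM m).
Qed.

(** Such a step up the tree forces a coordinate outside [c.2] into the support of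
    every point over the new wedge, so that a long chain of steps forces large
    supports. *)
Definition extends (c c' : T * set G) : Prop :=
  [/\ (c.1 < c'.1)%O, c.2 `<=` c'.2
    & forall x, (c'.1 <= node x)%O -> exists2 g, sp x g & c'.2 g /\ ~ c.2 g].

Definition extension_chain (C : set (T * set G)) : Prop :=
  (forall c, C c -> countable_node c.1 /\ countable c.2) /\
  (forall c c', C c -> C c' -> [\/ c = c', extends c c' | extends c' c]).

Lemma chain_nodes C : extension_chain C ->
  total_on (fst @` C) (fun s s' => (s <= s')%O).
Proof.
move=> [_ tot] _ _ [c Cc <-] [c' Cc' <-].
by have [->|[l _ _]|[l _ _]] := tot _ _ Cc Cc'; [left|left|right] => //; exact: ltW.
Qed.

(** A maximal chain is uncountable: a countable one would be extended further by
    [new_coordinates] applied to the supremum of its nodes and the union of its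
    sets of coordinates. *)
Lemma uncountable_extension_chain :
  exists2 C, extension_chain C & ~ countable C.
Proof.
have [C [chC maxC]] : exists C, extension_chain C /\
    forall B, C `<` B -> ~ extension_chain B.
  apply: Zorn_bigcup => F FP Ftot; split=> [c [B FB Bc]|c c' [B FB Bc] [B' FB' B'c']].
    by have [good _] := FP _ FB; exact: good.
  have [BB'|B'B] := Ftot _ _ FB FB'.
    by have [_ tot] := FP _ FB'; apply: tot => //; exact: BB'.
  by have [_ tot] := FP _ FB; apply: tot => //; exact: B'B.
exists C => // cC; have [good tot] := chC.
have [s sups] := chain_sup treeT (chain_nodes chC).
have [sub _] := sups.
have cs : countable_node s.
  apply: (sup_countable_node treeT (chain_nodes chC) sups).
    exact: sub_countable (card_image_le _ _) cC.
  by move=> _ [c Cc <-]; case: (good _ Cc).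
pose N := \bigcup_(c in C) c.2.
have cN : countable N by apply: bigcup_countable => // c /good[].
have [s' [M [ss' cs' cM NM new]]] := new_coordinates cN cs.
have above c : C c -> extends c (s', M).
  move=> Cc; split=> /=.
  - by apply: le_lt_trans ss'; apply: sub; exists c.
  - by apply: subset_trans NM => g cg; exists c.
  - move=> x /new[g xg [Mg nNg]]; exists g => //; split=> // cg.
    by apply: nNg; exists c.
apply: (maxC (C `|` [set (s', M)])).
  split; first by move=> c Cc; left.
  move=> sCC; have /above[] : C (s', M) by apply: sCC; right.
  by rewrite ltxx.
split=> [c [/good//|->//]|c c' [Cc|->] [Cc'|->]].
- exact: tot.
- by constructor 2; exact: above.
- by constructor 3; exact: above.
- by constructor 1.
Qed.

(** Let [x] be a point over the supremum of the nodes of an uncountable chain.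
    Only countably many members of the chain fail to extend a given one, so some
    [c] in the chain extends members that cover all the coordinates of the
    support of [x] ever reached by the chain, and some [c'] extends [c]: it should
    bring a new coordinate of that support. *)
Lemma no_surjection_onto_tree : False.
Proof.
have [C chC ncC] := uncountable_extension_chain; have [good tot] := chC.
have escape (K : set (T * set G)) : countable K -> K `<=` C ->
    exists2 c', C c' & forall c, K c -> extends c c'.
  move=> cK KC; apply: contrapT => noc; apply: ncC.
  apply: (@sub_countable _ _ _
    (\bigcup_(c in K) [set c' | C c' /\ ~ extends c c'])).
    apply: subset_card_le => c' Cc'; apply: contrapT => nc'.
    apply: noc; exists c' => // c Kc; apply: contrapT => ncc'.
    by apply: nc'; exists c.
  apply: bigcup_countable => // c /KC Cc.
  apply: (@countable_inj_on _ _ fst _ (below c.1 `|` [set c.1])).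
  - move=> c1 c2 [Cc1 _] [Cc2 _] e.
    by have [//|[]|[]] := tot _ _ Cc1 Cc2; rewrite e ltxx.
  - move=> c' [Cc' ncc']; have [->|//|[l _ _]] := tot _ _ Cc Cc'; first by right.
    by left.
  - by apply: countable_setU => //; case: (good _ Cc).
have [c0 Cc0 _] := escape set0 (countable0 _) (sub0set _).
have [t [tub _]] := chain_sup treeT (chain_nodes chC).
have [x _ fx] : range f t by rewrite fsurj.
have step (g : G) : exists c, C c /\ ((exists2 c', C c' & c'.2 g) -> c.2 g).
  have [[c Cc cg]|noc] := pselect (exists2 c, C c & c.2 g); first by exists c.
  by exists c0.
have [pick pickE] := choice step.
have [c Cc cext] : exists2 c', C c' & forall c, (pick @` sp x) c -> extends c c'.
  apply: escape; first exact: sub_countable (card_image_le _ _) (sp_countable x).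
  by move=> _ [g _ <-]; case: (pickE g).
have [c' Cc' /(_ c erefl)[_ _ new]] : exists2 c', C c' &
    forall c1, [set c] c1 -> extends c1 c'.
  by apply: escape => // _ ->.
have [|g xg [c'g ncg]] := new x.
  by rewrite /node fx; apply: tub; exists c'.
apply: ncg; have [|_ sub _] := cext (pick g); first by exists g.
by apply: sub; apply: (pickE g).2; exists c'.
Qed.

End Image.

Lemma not_weakly_corson (R : realType) : ~ weakly_corson R (coarse_wedge T).
Proof.
move=> [_ [L [G [A [AS ccA [phi [psi [_ psic phiK _]]]]]] [f fc fs]]].
apply: (no_surjection_onto_tree AS ccA (f := f \o psi)).
  by move=> x; apply: continuous_comp; [exact: psic|exact: fc].
apply/seteqP; split=> // t _; have [x _ <-] : range f t by rewrite fs.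
by exists (phi x) => //=; rewrite phiK.
Qed.

End NotWeaklyCorson.

Theorem mainTheorem1 (R : realType) (d : Order.disp_t) (T : porderType d)
    (omega1 : Ord) (Homega1 : is_omega1 omega1)
    (HT : full_binary_tree T) (HTht : tree_ht T (ord_succ omega1)) :
  (forall F : set (coarse_wedge T), closed F ->
     valdivia R (set_type F) /\ weakly_valdivia R (set_type F)) /\
  ~ weakly_corson R (coarse_wedge T).
Proof.
have treeT := full_binary_omega1_tree Homega1 HT HTht.
split; last exact: not_weakly_corson treeT (full_binary_splits Homega1 HT HTht) R.
move=> F clF; have vF := closed_valdivia treeT R clF.
by split=> //; exact: weakly_valdivia_of_valdivia.
Qed.
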